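(* Let $N\ge1$ and, for $i=1,\dots,N$, let $\bar{\mathcal S}_i\subseteq\mathbb R^3$ be the admissible operating-point set of converter $i$. For every $\mathcal O=[\mathcal O_1^\top,\dots,\mathcal O_N^\top]^\top$ with $\mathcal O_i\in\bar{\mathcal S}_i$ let $G(\cdot,\mathcal O)\in\mathcal{RH}_\infty^{m\times m}$ be block-diagonal, $$G(s,\mathcal O)=\operatorname{diag}\{G_1(s,\mathcal O_1),\dots,G_N(s,\mathcal O_N)\},$$ with square blocks, the $i$-th block depending only on $s$ and $\mathcal O_i$. Let $H\in\mathbb R^{m\times m}$ be a constant symmetric positive-definite matrix. Let $\mathcal D_i=\{\mathcal O_i\in\bar{\mathcal S}_i: M_i(\mathcal O_i)>0\}$ be the decentralized stability operating region of converter $i$, where $M_i$ is the decentralized stability margin $$M_i(\mathcal O_i)=\operatorname{dist}\left\{\bigcup_{\omega\in[0,\infty)}P_{xz}\bigl(G_i(j\omega,\mathcal O_i)\bigr),\ \bigcup_{\tau\in(0,1]}P_{xz}\left(-\tfrac1\tau H^{-1}\right)\right\}.$$ If $\mathcal O_i\in\mathcal D_i$ for all $i\in\{1,\dots,N\}$ (equivalently, $\mathcal O\in\mathcal D_1\times\cdots\times\mathcal D_N$), then the closed-loop system $G(s,\mathcal O)\,\#\,H$ is stable.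
   Context: Operating points: $\mathcal O_i=[P_i,Q_i,V_i]^\top\in\mathbb R^3$ (active power, reactive power, voltage magnitude). The admissible set is $\bar{\mathcal S}_i=\{\mathcal O_i: P_i^2+Q_i^2\le\kappa_i^2,\ \angle(P_i+\mathrm jQ_i)\in\Psi_i,\ V_i\in\mathcal V_i\}$ for given $\kappa_i$, angle range $\Psi_i$ and voltage set $\mathcal V_i$. $\mathcal{RH}_\infty^{m\times m}$ is the set of $m\times m$ proper real-rational transfer matrices with all poles in the open left half-plane. $G\,\#\,H$ denotes the negative feedback interconnection of $G$ and $H$ (it models the interconnection of the converters, $G$, with the power network, $H$). With $G\in\mathcal{RH}_\infty$ and $H$ constant, it is stable iff $I+GH$ is invertible with $(I+GH)^{-1}\in\mathcal{RH}_\infty^{m\times m}$. For $A\in\mathbb C^{n\times n}$ the $x$-$z$ graph is $P_{xz}(A)=\{(\Re(v^*Av),\|Av\|^2): v\in\mathbb C^n,\|v\|=1\}\subset\mathbb R^2$, where $\|\cdot\|$ is the Euclidean norm and $v^*$ the conjugate transpose. For sets $A,B\subset\mathbb R^2$, $\operatorname{dist}\{A,B\}=\inf_{x\in A,\,y\in B}\|x-y\|$. *)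

(* Defs.v *)
From mathcomp Require Import all_boot all_order all_algebra.
From mathcomp Require Import complex.
From mathcomp Require Import boolp classical_sets reals ereal trigo.

Set Implicit Arguments.
Unset Strict Implicit.
Unset Printing Implicit Defensive.

Import Order.TTheory GRing.Theory Num.Theory.

Local Open Scope classical_set_scope.
Local Open Scope complex_scope.
Local Open Scope sesquilinear_scope.
Local Open Scope ring_scope.

Lemma frac_numdenE (A : idomainType) (g : {fraction A}) :
  g = tofrac \n_(repr g) / tofrac \d_(repr g).
Proof.
set r := repr g.
have d0 : tofrac \d_r != 0 :> {fraction A} by rewrite tofrac_eq0 denom_ratioP.
apply: (mulIf d0); rewrite (divfK d0) -[g in LHS]reprK -/r.
unlock FracField.tofrac; rewrite -[LHS]FracField.pi_mul.
apply/eqmodP; rewrite /= FracField.equivfE /FracField.mulf.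
by rewrite !numden_Ratio ?mulr1 ?oner_neq0 ?denom_ratioP // mulrC.
Qed.

Lemma frac_reduce (F : fieldType) (p q : {poly F}) : q != 0 ->
  tofrac p / tofrac q =
  tofrac (p %/ gcdp p q) / tofrac (q %/ gcdp p q) :> {fraction {poly F}}.
Proof.
move=> q0; set c := gcdp p q.
have c0 : tofrac c != 0 :> {fraction {poly F}}.
  by rewrite tofrac_eq0 gcdp_eq0 (negPf q0) andbF.
have pE : p = p %/ c * c by rewrite (divpK (dvdp_gcdl _ _)).
have qE : q = q %/ c * c by rewrite (divpK (dvdp_gcdr _ _)).
have {1}-> : tofrac p = tofrac (p %/ c) * tofrac c by rewrite -tofracM -pE.
have {1}-> : tofrac q = tofrac (q %/ c) * tofrac c by rewrite -tofracM -qE.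
by rewrite -mulf_div (divff c0) mulr1.
Qed.

(* A real-rational transfer function is an element of R(s).  The numerator and
   denominator below are the canonical representative in lowest terms, so that
   the roots of [tf_den g] are exactly the poles of [g]. *)
Notation tf R := {fraction {poly R}}.

Definition tf_num (R : realType) (g : tf R) : {poly R} :=
  let r := repr g in \n_r %/ gcdp \n_r \d_r.

Definition tf_den (R : realType) (g : tf R) : {poly R} :=
  let r := repr g in \d_r %/ gcdp \n_r \d_r.

Lemma tf_den_neq0 (R : realType) (g : tf R) : tf_den g != 0.
Proof.
by rewrite dvdp_div_eq0 ?dvdp_gcdr ?denom_ratioP.
Qed.

Lemma tf_coprime (R : realType) (g : tf R) : coprimep (tf_num g) (tf_den g).
Proof.
by apply: coprimep_div_gcd; rewrite (denom_ratioP (repr g)) orbT.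
Qed.

Lemma tf_fracE (R : realType) (g : tf R) :
  g = tofrac (tf_num g) / tofrac (tf_den g).
Proof. by rewrite [LHS]frac_numdenE (frac_reduce _ (denom_ratioP _)). Qed.

Definition is_pole (R : realType) (g : tf R) (z : R[i]) : Prop :=
  root (map_poly (real_complex R) (tf_den g)) z.

Definition proper (R : realType) (g : tf R) : Prop :=
  (size (tf_num g) <= size (tf_den g))%N.

(* g(z); meaningful when z is not a pole of g. *)
Definition tf_eval (R : realType) (g : tf R) (z : R[i]) : R[i] :=
  (map_poly (real_complex R) (tf_num g)).[z] /
  (map_poly (real_complex R) (tf_den g)).[z].

Definition tf_const (R : realType) (c : R) : tf R := tofrac c%:P.

Definition RHinf (R : realType) (m : nat) (G : 'M[tf R]_m) : Prop :=
  forall i j, proper (G i j) /\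
    forall z : R[i], is_pole (G i j) z -> complex.Re z < 0.

Definition freq_resp (R : realType) (m : nat) (G : 'M[tf R]_m) (w : R) :
  'M[R[i]]_m := map_mx (fun g => tf_eval g (0 +i* w)) G.

(* Stability of the negative feedback interconnection G # H, for G in RHinf
   and H constant. *)
Definition feedback_stable (R : realType) (m : nat) (G : 'M[tf R]_m)
    (H : 'M[R]_m) : Prop :=
  let S := 1%:M + G *m map_mx (@tf_const R) H in
  S \in unitmx /\ RHinf (invmx S).

Definition sym_posdef (R : realType) (m : nat) (H : 'M[R]_m) : Prop :=
  H^T = H /\ forall x : 'cV[R]_m, x != 0 -> 0 < (x^T *m H *m x) 0 0.

Definition enorm (R : realType) (n : nat) (v : 'cV[R[i]]_n) : R :=
  Num.sqrt (\sum_k (complex.Re (v k 0) ^+ 2 + complex.Im (v k 0) ^+ 2)).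

Definition xz_graph (R : realType) (n : nat) (A : 'M[R[i]]_n) : set (R * R) :=
  [set p | exists2 v : 'cV[R[i]]_n, enorm v = 1 &
    p = (complex.Re ((v^t* *m A *m v) 0 0), enorm (A *m v) ^+ 2)].

(* The library norm on R * R is the sup norm, hence this definition. *)
Definition edist2 (R : realType) (x y : R * R) : R :=
  Num.sqrt ((x.1 - y.1) ^+ 2 + (x.2 - y.2) ^+ 2).

Definition set_dist (R : realType) (A B : set (R * R)) : \bar R :=
  ereal_inf [set (edist2 x y)%:E | x in A & y in B].

(* Operating points are column vectors [P, Q, V]^T. *)
Definition op_P (R : realType) (o : 'cV[R]_3) : R := o 0 0.
Definition op_Q (R : realType) (o : 'cV[R]_3) : R := o 1 0.
Definition op_V (R : realType) (o : 'cV[R]_3) : R := o 2 0.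

(* theta is an angle of P + jQ, in radians and not restricted to (-pi, pi];
   every theta is an angle of 0. *)
Definition is_angle (R : realType) (P Q theta : R) : Prop :=
  P = Num.sqrt (P ^+ 2 + Q ^+ 2) * cos theta /\
  Q = Num.sqrt (P ^+ 2 + Q ^+ 2) * sin theta.

Definition admissible (R : realType) (kappa : R) (Psi V : set R) :
    set 'cV[R]_3 :=
  [set o | [/\ op_P o ^+ 2 + op_Q o ^+ 2 <= kappa ^+ 2,
               exists2 theta, Psi theta & is_angle (op_P o) (op_Q o) theta &
               V (op_V o)]].

(* M(o) for a single converter g of size n, against the network matrix H of
   size m. *)
Definition stab_margin (R : realType) (n m : nat)
    (g : 'cV[R]_3 -> 'M[tf R]_n) (H : 'M[R]_m) (o : 'cV[R]_3) : \bar R :=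
  set_dist
    (\bigcup_(w in [set w : R | 0 <= w]) xz_graph (freq_resp (g o) w))
    (\bigcup_(tau in [set tau : R | 0 < tau <= 1])
        xz_graph (map_mx (real_complex R) (- tau^-1 *: invmx H))).

Definition stab_region (R : realType) (n m : nat) (S : set 'cV[R]_3)
    (g : 'cV[R]_3 -> 'M[tf R]_n) (H : 'M[R]_m) : set 'cV[R]_3 :=
  [set o | S o /\ (0 < stab_margin g H o)%E].

(* Main.v *)
(* Let K = H^-1 with extreme eigenvalues l1 <= l2.  The sets P_xz(- t K), t >= 1,
   sweep out exactly the points (x, z) with z >= x^2 and
   z + t (l1 + l2) x + t^2 l1 l2 <= 0 for some t >= 1.  By Cauchy-Schwarz every
   P_xz(G_i(jw)) lies in z >= x^2, so a positive margin makes these affine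
   expressions in (x, z) positive on it, a condition stable under the convex
   combinations that assemble the blocks.  Hence I + tau G(jw) H is nonsingular
   for tau in [0, 1] and all w, infinity included by a limit.  Writing
   G = Gh / q with a common denominator q, the polynomials
   det (q I + tau Gh H) have constant degree and no root on the imaginary axis,
   so their roots stay in the open left half-plane from tau = 0 to tau = 1. *)
Require Import Defs.
From mathcomp Require Import all_boot all_order all_algebra.
From mathcomp Require Import complex.
From mathcomp Require Import boolp classical_sets reals ereal trigo.
From mathcomp Require Import perm ring lra.

Import Order.TTheory GRing.Theory Num.Theory.
Import Normc.
Local Open Scope classical_set_scope.
Local Open Scope sesquilinear_scope.
Local Open Scope ring_scope.

(** * Polynomials in the closed right half-plane *)

Section HalfPlane.
Context {R : realType}.
Implicit Types (z r : R[i]) (p : {poly R[i]}).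

Lemma normc_ge0 z : 0 <= normc z.
Proof. by case: z => a b; rewrite /normc sqrtr_ge0. Qed.

Lemma normcX z k : normc (z ^+ k) = normc z ^+ k.
Proof.
by elim: k => [|k IH]; rewrite ?expr0 ?normc1 // !exprS normcM IH.
Qed.

Lemma normc_sqr z : normc z ^+ 2 = complex.Re z ^+ 2 + complex.Im z ^+ 2.
Proof. by case: z => a b; rewrite /= sqr_sqrtr // addr_ge0 ?sqr_ge0. Qed.

Lemma normc_real (x : R) : normc (real_complex R x) = `|x|.
Proof. by rewrite /= expr0n addr0 sqrtr_sqr. Qed.

Lemma normc_eq0 z : (normc z == 0) = (z == 0).
Proof.
apply/eqP/eqP => [/eq0_normc //|->]; exact: normc0.
Qed.

Lemma normc_sum (I : Type) (s : seq I) (P : pred I) (F : I -> R[i]) :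
  normc (\sum_(i <- s | P i) F i) <= \sum_(i <- s | P i) normc (F i).
Proof.
elim/big_rec2: _ => [|i x y _ le_xy]; first by rewrite normc0.
by apply: le_trans (le_normcD _ _) _; rewrite lerD2l.
Qed.

Lemma normc_prod (I : Type) (s : seq I) (F : I -> R[i]) :
  normc (\prod_(i <- s) F i) = \prod_(i <- s) normc (F i).
Proof.
by elim/big_rec2: _ => [|i x y _ <-]; rewrite ?normc1 ?normcM.
Qed.

Lemma ler_Re_normc z : `|complex.Re z| <= normc z.
Proof.
by rewrite -(ler_pXn2r (n := 2)) ?nnegrE ?normc_ge0 // normc_sqr real_normK
  ?num_real // lerDl sqr_ge0.
Qed.

(** The factor [1 + normc z] on both sides stands in for the exponent [D - 1], which would be
    truncated at [D = 0]. *)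
Lemma normc_horner_le p D (M : R) z :
  (size p <= D)%N -> (forall i, (i < D)%N -> normc p`_i <= M) ->
  normc p.[z] * (1 + normc z) <= D%:R * M * (1 + normc z) ^+ D.
Proof.
move=> sp pM; have z1 : 1 <= 1 + normc z by rewrite lerDl normc_ge0.
(* Stated under an index [i]: for [D = 0] nothing bounds [M] from below. *)
have M0 (i : 'I_D) : 0 <= M by apply: le_trans (normc_ge0 _) (pM i _).
rewrite (horner_coef_wide _ sp).
apply: (@le_trans _ _ ((\sum_(i < D) normc (p`_i * z ^+ i)) * (1 + normc z))).
  by rewrite ler_wpM2r ?normc_sum ?(le_trans ler01).
have -> : D%:R * M * (1 + normc z) ^+ D = \sum_(i < D) M * (1 + normc z) ^+ D.
  by rewrite sumr_const card_ord -mulrA mulr_natl.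
rewrite mulr_suml.
apply: ler_sum => i _; rewrite normcM normcX -mulrA ler_pM ?pM //.
- exact: normc_ge0.
- by rewrite mulr_ge0 ?exprn_ge0 ?normc_ge0 ?(le_trans ler01).
rewrite (@le_trans _ _ ((1 + normc z) ^+ i.+1)) ?ler_weXn2l //.
rewrite exprSr ler_pM2r ?(lt_le_trans ltr01) //.
by rewrite lerXn2r ?nnegrE ?normc_ge0 ?(le_trans ler01) // lerDr.
Qed.

Lemma closed_poly_normc p : p != 0 -> exists rs : seq R[i],
  [/\ forall r, r \in rs -> root p r, size rs = (size p).-1 &
      forall z, normc p.[z] = normc (lead_coef p) * \prod_(r <- rs) normc (z - r)].
Proof.
move=> p0; have [rs pE] := closed_field_poly_normal p; exists rs; split.
- by move=> r rs_r; rewrite pE rootZ ?lead_coef_eq0 // root_prod_XsubC.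
- by rewrite pE size_scale ?lead_coef_eq0 // size_prod_XsubC.
- move=> z; rewrite {1}pE hornerZ normcM horner_prod normc_prod.
  by under eq_bigr do rewrite hornerXsubC.
Qed.

(** With [a = - Re r], both [a <= |z - r|] and [|z| <= |z - r| + |r|] hold; the constant
    [a / (1 + |r| + a)] combines the two. *)
Lemma open_lhp_linear_ge r : complex.Re r < 0 ->
  exists2 c : R, 0 < c &
    forall z, 0 <= complex.Re z -> c * (1 + normc z) <= normc (z - r).
Proof.
move=> r0; set a := - complex.Re r; have a0 : 0 < a by rewrite oppr_gt0.
have nr := normc_ge0 r.
have d0 : 0 < 1 + normc r + a by lra.
exists (a / (1 + normc r + a)); first by rewrite divr_gt0.
move=> z z0; rewrite mulrAC ler_pdivrMr //.
have h1 : a <= normc (z - r).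
  apply: le_trans (ler_Re_normc _); apply: le_trans (ler_norm _).
  by move: z0; rewrite /a; case: (z) (r) => [x y] [u v] /=; lra.
have h2 : normc z <= normc (z - r) + normc r.
  by rewrite -{1}(subrK r z) le_normcD.
by nra.
Qed.

(* A polynomial with no root in the closed right half-plane is there of the
   exact order of growth of its degree; in particular it absorbs every small
   perturbation of its coefficients. *)
Lemma open_lhp_horner_ge p : p != 0 ->
  (forall z, root p z -> complex.Re z < 0) ->
  exists2 c : R, 0 < c & forall z, 0 <= complex.Re z ->
    c * (1 + normc z) ^+ (size p).-1 <= normc p.[z].
Proof.
move=> p0 pH; have [rs [rsp <- pE]] := closed_poly_normc p p0.
have : forall r, r \in rs -> complex.Re r < 0 by move=> r /rsp /pH.
have l0 : 0 < normc (lead_coef p).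
  by rewrite lt0r normc_ge0 andbT normc_eq0 lead_coef_eq0.
suff: (forall r, r \in rs -> complex.Re r < 0) -> exists2 c : R, 0 < c &
    forall z, 0 <= complex.Re z ->
      c * (1 + normc z) ^+ size rs <= \prod_(r <- rs) normc (z - r).
  move=> /[apply] -[c c0 cP]; exists (normc (lead_coef p) * c).
    exact: mulr_gt0.
  by move=> z /cP; rewrite pE -mulrA ler_pM2l.
elim: {rsp pE} rs => [_|r rs IH rsP].
  by exists 1 => // z _; rewrite big_nil mul1r expr0.
have [|c c0 cP] := IH; first by move=> u us; apply: rsP; rewrite inE us orbT.
have [|d d0 dP] := @open_lhp_linear_ge r; first exact: rsP (mem_head _ _).
exists (d * c); first exact: mulr_gt0.
move=> z z0; rewrite big_cons /= exprS mulrACA.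
have z1 : 0 <= 1 + normc z by rewrite addr_ge0 ?normc_ge0.
apply: ler_pM; [| |exact: dP|exact: cP].
- by rewrite mulr_ge0 ?(ltW d0).
- by rewrite mulr_ge0 ?exprn_ge0 ?(ltW c0).
Qed.

(** Each factor satisfies [|z - r| >= Re z]. The constant involves the leading coefficient alone, so
    the bound stays uniform along a family whose roots may approach the axis. *)
Lemma closed_lhp_horner_ge p z : p != 0 ->
  (forall r, root p r -> complex.Re r <= 0) -> 0 <= complex.Re z ->
  normc (lead_coef p) * complex.Re z ^+ (size p).-1 <= normc p.[z].
Proof.
move=> p0 pH z0; have [rs [rsp <- ->]] := closed_poly_normc p p0.
rewrite ler_wpM2l ?normc_ge0 // -(iter_mulr_1 (size rs)) -(count_predT rs).
rewrite -big_const_seq big_seq [X in _ <= X]big_seq.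
apply: ler_prod => r /rsp /pH r0; rewrite z0 /=.
apply: le_trans (ler_Re_normc _); apply: le_trans (ler_norm _).
by move: z0 r0; case: (z) (r) => [x y] [u v] /=; lra.
Qed.

End HalfPlane.

(** * Homotopy of Hurwitz polynomials *)

Section Homotopy.
Context {R : realType}.
Local Notation "p ^C" := (map_poly (real_complex R) p).

Definition hurwitz (p : {poly R}) : Prop :=
  forall z : R[i], root p^C z -> complex.Re z < 0.

Lemma poly_lipschitz01 (p : {poly R}) : exists2 L : R, 0 <= L &
  forall x y, 0 <= x <= 1 -> 0 <= y <= 1 -> `|p.[x] - p.[y]| <= L * `|x - y|.
Proof.
(* The bound [M] on [|p|] is carried through the induction because the Lipschitz constant of
   [p * 'X] involves it. *)
suff [L [M [L0 M0 LP _]]] : exists L M : R, [/\ 0 <= L, 0 <= M,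
    forall x y, 0 <= x <= 1 -> 0 <= y <= 1 -> `|p.[x] - p.[y]| <= L * `|x - y|
    & forall x, 0 <= x <= 1 -> `|p.[x]| <= M] by exists L.
elim/poly_ind: p => [|p a [L [M [L0 M0 LP MP]]]].
  by exists 0, 0; split=> // [x y _ _|x _]; rewrite !horner0 ?subrr normr0 ?mul0r.
exists (L + M), (M + `|a|); split; rewrite ?addr_ge0 //.
  move=> x y x01 y01; rewrite !hornerMXaddC.
  have -> : p.[x] * x + a - (p.[y] * y + a)
          = (p.[x] - p.[y]) * x + p.[y] * (x - y) by ring.
  apply: le_trans (ler_normD _ _) _; rewrite !normrM mulrDl.
  apply: lerD; last by rewrite ler_wpM2r ?MP.
  have /andP[x0 x1] := x01; rewrite (ger0_norm x0).
  by apply: le_trans (LP _ _ x01 y01); rewrite ler_piMr.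
move=> x /[dup] x01 /andP[x0 x1]; rewrite hornerMXaddC.
apply: le_trans (ler_normD _ _) _; rewrite lerD2r normrM (ger0_norm x0).
by apply: le_trans (MP _ x01); rewrite ler_piMr.
Qed.

(** * Openness and closedness of the Hurwitz property along a family of constant degree *)

Section Family.
Variables (P : R -> {poly R}) (D : nat) (c : nat -> {poly R}).
Hypothesis Pc : forall t i, (P t)`_i = (c i).[t].
Hypothesis sizeP : forall t, 0 <= t <= 1 -> size (P t) = D.+1.
Hypothesis axisP : forall t w, 0 <= t <= 1 -> ~~ root (P t)^C (Complex 0 w).

Let size_PC t : 0 <= t <= 1 -> size (P t)^C = D.+1.
Proof. by move=> t01; rewrite size_map_poly sizeP. Qed.

Let PC_neq0 t : 0 <= t <= 1 -> (P t)^C != 0.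
Proof. by move=> t01; rewrite -size_poly_eq0 size_PC. Qed.

Let coef_lipschitz : exists2 L : R, 0 <= L & forall i x y, (i < D.+1)%N ->
  0 <= x <= 1 -> 0 <= y <= 1 -> `|(P x)`_i - (P y)`_i| <= L * `|x - y|.
Proof.
elim: D.+1 => [|k [L L0 LP]]; first by exists 0.
have [M M0 MP] := poly_lipschitz01 (c k); exists (L + M); first exact: addr_ge0.
move=> i x y; rewrite ltnS leq_eqVlt mulrDl => /orP[/eqP ->|ik] x01 y01.
  by rewrite !Pc (le_trans (MP _ _ x01 y01)) // lerDr mulr_ge0.
by rewrite (le_trans (LP _ _ _ ik x01 y01)) // lerDl mulr_ge0.
Qed.

Let perturb : exists2 B : R, 0 <= B & forall x y, 0 <= x <= 1 -> 0 <= y <= 1 ->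
  `|lead_coef (P x) - lead_coef (P y)| <= B * `|x - y| /\
  forall z, normc ((P x)^C.[z] - (P y)^C.[z]) <= B * `|x - y| * (1 + normc z) ^+ D.
Proof.
have [L L0 LP] := coef_lipschitz.
exists (D.+1%:R * L); first by rewrite mulr_ge0.
move=> x y x01 y01; split.
  rewrite !lead_coefE !sizeP //=; apply: le_trans (LP _ _ _ (ltnSn D) x01 y01) _.
  by rewrite ler_wpM2r // ler_peMl // ler1n.
move=> z; have z1 : 0 < 1 + normc z by rewrite (lt_le_trans ltr01) // lerDl normc_ge0.
rewrite -(ler_pM2r z1) -hornerN -hornerD -[X in _ <= X]mulrA -exprSr -mulrA.
apply: normc_horner_le => [|i iD].
  by rewrite (leq_trans (size_polyD _ _)) // size_polyN !size_PC // maxnn.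
rewrite coefB !coef_map -rmorphB normc_real; exact: LP.
Qed.

(** A root [z] of [P y] with [Re z >= 0] would give [k (1 + |z|)^D <= |P x (z) - P y (z)| <= B |x -
    y| (1 + |z|)^D]. The powers cancel, so roots of every modulus are excluded at once. *)
Let hurwitz_open x : 0 <= x <= 1 -> hurwitz (P x) ->
  exists2 d : R, 0 < d &
    forall y, 0 <= y <= 1 -> `|x - y| < d -> hurwitz (P y).
Proof.
move=> x01 xH; have [B B0 BP] := perturb.
have [k k0 kP] := open_lhp_horner_ge _ (PC_neq0 _ x01) xH.
have B1 : 0 < B + 1 by lra.
exists (k / (B + 1)) => [|y y01]; first exact: divr_gt0.
rewrite ltr_pdivlMr // => xy z /eqP yz; rewrite ltNge; apply/negP => z0.
have := kP z z0; rewrite size_PC //= => h1.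
have [_ /(_ z)] := BP x y x01 y01; rewrite yz subr0 => h2.
have z1 : 0 < (1 + normc z) ^+ D by rewrite exprn_gt0 // ltr_pwDl ?normc_ge0.
have := le_trans h1 h2; rewrite ler_pM2r //.
by have := normr_ge0 (x - y); nra.
Qed.

(** Roots on the axis are excluded by [axisP]. A root [z] of [P x] with [Re z > 0] would force
    [|lead (P y)| (Re z)^D <= |P y (z)| <= B |x - y| (1 + |z|)^D] for Hurwitz [P y] with [y]
    arbitrarily near [x], while [lead (P y)] tends to [lead (P x)], which is nonzero. *)
Let hurwitz_closed x : 0 <= x <= 1 ->
  (forall d : R, 0 < d -> exists y,
     [/\ 0 <= y <= 1, `|x - y| < d & hurwitz (P y)]) ->
  hurwitz (P x).
Proof.
move=> x01 xP z xz; have [B B0 BP] := perturb.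
rewrite ltNge le_eqVlt; apply/negP => /orP[/eqP z0|z0].
  have /negP := axisP x (complex.Im z) x01; apply; rewrite z0.
  by case: z {z0} xz.
set r := complex.Re z ^+ D; have r0 : 0 < r by rewrite exprn_gt0.
set s := (1 + normc z) ^+ D.
have s0 : 0 < s by rewrite exprn_gt0 // ltr_pwDl ?normc_ge0.
have l0 : 0 < `|lead_coef (P x)|.
  by rewrite normr_gt0 lead_coef_eq0 -size_poly_eq0 sizeP.
have e0 : 0 < B * s + B * r + 1.
  by rewrite ltr_pwDr // addr_ge0 ?mulr_ge0 // ltW.
(* This radius contradicts [|lead (P x)| r <= |x - y| (B s + B r)], which follows from [h5] and
   [h6]; the summand 1 keeps the denominator positive. *)
have [|y [y01 xy yH]] := xP (`|lead_coef (P x)| * r / (B * s + B * r + 1)).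
  by rewrite divr_gt0 ?mulr_gt0.
move: xy; rewrite ltr_pdivlMr // => xy.
have [h1 /(_ z)] := BP x y x01 y01; rewrite (eqP xz) sub0r normcN => h2.
have := @closed_lhp_horner_ge _ (P y)^C z (PC_neq0 _ y01).
rewrite size_PC // lead_coef_map normc_real -/r => /(_ _ (ltW z0)) h3.
have {}h3 : `|lead_coef (P y)| * r <= normc (P y)^C.[z].
  by apply: h3 => u /yH /ltW.
have h4 : `|lead_coef (P x)| <= B * `|x - y| + `|lead_coef (P y)|.
  rewrite -{1}(subrK (lead_coef (P y)) (lead_coef (P x))).
  by apply: le_trans (ler_normD _ _) _; rewrite lerD2r.
have h5 : `|lead_coef (P y)| * r <= B * `|x - y| * s := le_trans h3 h2.
have := ler_wpM2r (ltW r0) h4; rewrite mulrDl => h6.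
have := normr_ge0 (x - y); nra.
Qed.

(** Continuation: the supremum [s] of the parameters reached from 0 is itself reached by closedness,
    and openness then rules out [s < 1]. *)
Lemma hurwitz_homotopy : hurwitz (P 0) -> hurwitz (P 1).
Proof.
move=> H0.
pose T := [set t : R | 0 <= t <= 1 /\ forall y, 0 <= y <= t -> hurwitz (P y)].
have T0 : T 0.
  by split=> [|y]; rewrite ?lexx ?ler01 // -eq_le => /eqP <-.
have T1 : ubound T 1 by move=> t [/andP[]].
have supT : has_sup T by split; [exists 0|exists 1].
set s := sup T.
have s0 : 0 <= s by apply: (sup_upper_bound supT).
have s1 : s <= 1 by apply: ge_sup => //; exists 0.
have s01 : 0 <= s <= 1 by rewrite s0.
have below y : 0 <= y < s -> hurwitz (P y).
  move=> /andP[y0 ys]; have e0 : 0 < s - y by rewrite subr_gt0.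
  have [t [_ tP]] := sup_adherent e0 supT; rewrite -/s subKr => yt.
  by apply: tP; rewrite y0 ltW.
have sH : hurwitz (P s).
  apply: hurwitz_closed => // d d0.
  have [t [t01 tP]] := sup_adherent d0 supT; rewrite -/s => st.
  exists t; split => //; last by apply: tP; case/andP: t01 => ->; rewrite lexx.
  have ts : t <= s by apply: sup_upper_bound.
  by rewrite ger0_norm ?subr_ge0 //; lra.
have [d d0 dP] := hurwitz_open s s01 sH.
move: (s1); rewrite le_eqVlt => /orP[/eqP <- //|lt_s1].
pose t := Num.min 1 (s + d / 2).
have st : s < t by rewrite lt_min lt_s1 /=; lra.
have t1 : t <= 1 by rewrite ge_min lexx.
have td : t <= s + d / 2 by rewrite ge_min lexx orbT.
suff : T t by move=> /(sup_upper_bound supT); rewrite -/s leNgt st.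
split=> [|y /andP[y0 yt]]; first by rewrite t1 (le_trans s0) // ltW.
have [ys|sy] := ltP y s; first by apply: below; rewrite y0.
apply: dP; first by rewrite y0 (le_trans yt).
by rewrite ler0_norm ?subr_le0 //; lra.
Qed.

End Family.
End Homotopy.

(** * Determinants and transfer matrices *)

Section Determinants.
Context {F : comNzRingType}.

(** Here [d] only bounds the degrees, so the coefficient may vanish. In the Cauchy product every
    term but that of index [d] has a factor beyond its degree bound. *)
Lemma prod_coef (I : Type) (s : seq I) (p : I -> {poly F}) d :
  (forall i, size (p i) <= d.+1)%N ->
  (size (\prod_(i <- s) p i)%R <= (size s * d).+1)%N /\
  (\prod_(i <- s) p i)`_(size s * d) = \prod_(i <- s) (p i)`_d.
Proof.
move=> sp; elim: s => [|i s [IHs IHc]].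
  by rewrite !big_nil size_poly1 mul0n coef1.
rewrite !big_cons /= mulSn; split.
  apply: leq_trans (size_polyMleq _ _) _; rewrite -subn1 leq_subLR add1n.
  by apply: leq_trans (leq_add (sp i) IHs) _; rewrite addSn addnS.
rewrite coefM (bigD1 (Ordinal (leq_addr (size s * d) d : d < (d + size s * d).+1)%N)) //=.
rewrite addKn IHc [X in _ + X]big1 ?addr0 // => k /negP kd.
have [kd'|dk] := ltnP d k.
  by rewrite nth_default ?mul0r // (leq_trans (sp i)).
rewrite [X in _ * X]nth_default ?mulr0 // (leq_trans IHs) //.
have {}kd : (k < d)%N.
  rewrite ltn_neqAle dk andbT; apply/eqP => e; apply: kd; apply/eqP.
  exact: val_inj.
by rewrite ltn_subRL ltn_add2r.
Qed.

(** This captures the behaviour at infinity: when the matrix of coefficients of degree [d] is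
    nonsingular, the determinant has degree exactly [n * d]. *)
Lemma det_coef n (A : 'M[{poly F}]_n) d :
  (forall i j, size (A i j) <= d.+1)%N ->
  (size (\det A) <= (n * d).+1)%N /\
  (\det A)`_(n * d) = \det (map_mx (fun p : {poly F} => p`_d) A).
Proof.
move=> sA; rewrite /determinant.
have prodE (s : 'S_n) : (size (\prod_i A i (s i))%R <= (n * d).+1)%N /\
    (\prod_i A i (s i))`_(n * d) = \prod_i (A i (s i))`_d.
  have := @prod_coef _ (index_enum 'I_n) (fun i => A i (s i)) d.
  by rewrite /index_enum -enumT size_enum_ord; apply.
split.
  apply: (big_ind (fun p : {poly F} => size p <= (n * d).+1)%N).
  - by rewrite size_poly0.
  - move=> p q sp sq; apply: leq_trans (size_polyD _ _) _.
    by rewrite geq_max sp.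
  - by move=> s _; rewrite size_Msign; case: (prodE s).
rewrite coef_sum; apply: eq_bigr => s _.
case: (perm.odd_perm s).
  rewrite !expr1 !mulN1r coefN; have [_ ->] := prodE s.
  by congr (- _); apply: eq_bigr => i _; rewrite mxE.
rewrite !expr0 !mul1r; have [_ ->] := prodE s.
by apply: eq_bigr => i _; rewrite mxE.
Qed.

End Determinants.

(** * Transfer functions: arbitrary representations and common denominators *)

Section TransferFunctions.
Context {R : realType}.
Local Notation "p ^C" := (map_poly (real_complex R) p).
Implicit Types (g : tf R) (a b : {poly R}).

Lemma tf_cross g a b : b != 0 -> g = tofrac a / tofrac b ->
  tf_num g * b = a * tf_den g.
Proof.
move=> b0 gE; apply/eqP; rewrite -tofrac_eq !tofracM.
have d0 : tofrac (tf_den g) != 0 :> tf R by rewrite tofrac_eq0 tf_den_neq0.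
have b0' : tofrac b != 0 :> tf R by rewrite tofrac_eq0.
have e : tofrac (tf_num g) / tofrac (tf_den g) = tofrac a / tofrac b :> tf R.
  by rewrite -gE -tf_fracE.
by rewrite -(eqr_div _ _ d0 b0'); apply/eqP.
Qed.

(** Cross-multiplication and coprimality of the reduced pair; hence the poles of [g] lie among the
    roots of any denominator. *)
Lemma tf_den_dvd g a b : b != 0 -> g = tofrac a / tofrac b -> tf_den g %| b.
Proof.
move=> b0 /(tf_cross _ _ _ b0) e.
have : tf_den g %| tf_num g * b by rewrite e dvdp_mull.
by rewrite Gauss_dvdpr // coprimep_sym tf_coprime.
Qed.

Lemma tf_properP g a b : b != 0 -> g = tofrac a / tofrac b ->
  (size a <= size b)%N -> Defs.proper g.
Proof.
move=> b0 /(tf_cross _ _ _ b0) e sab; rewrite /Defs.proper.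
have [n0|n0] := eqVneq (tf_num g) 0; first by rewrite n0 size_poly0.
have d0 := tf_den_neq0 g.
have a0 : a != 0.
  by apply: contraNneq n0 => a0; move/eqP: e; rewrite a0 mul0r mulf_eq0 (negPf b0) orbF.
have /(congr1 (fun p : {poly R} => size p)) := e; rewrite !size_mul //.
move: n0 d0 a0 b0 sab; rewrite -!size_poly_gt0.
case: (size _) => // k; case: (size _) => // l; case: (size _) => // u.
case: (size _) => // v _ _ _ _; rewrite !addSn !addnS /= !ltnS => uv e'.
by rewrite -(leq_add2r v) [(k + v)%N](succn_inj e') [(u + l)%N]addnC leq_add2l.
Qed.

Lemma tf_evalE g a b z : b != 0 -> g = tofrac a / tofrac b ->
  ~~ root b^C z -> tf_eval g z = a^C.[z] / b^C.[z].
Proof.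
move=> b0 gE bz; rewrite /tf_eval.
have /(congr1 (fun p => p^C.[z])) := tf_cross _ _ _ b0 gE.
rewrite !rmorphM !hornerM => e.
have dz : (tf_den g)^C.[z] != 0.
  apply: contra bz; rewrite -/(root _ z) => dz.
  by apply: root_dvdp dz; rewrite dvdp_map (tf_den_dvd _ _ _ b0 gE).
by apply/eqP; rewrite eqr_div // e.
Qed.

(** The product of all entry denominators serves as [q]: each of its roots is a pole of some
    entry. *)
Lemma RHinf_common_den m (G : 'M[tf R]_m) : RHinf G ->
  exists (q : {poly R}) (Gh : 'M[{poly R}]_m),
    [/\ q != 0, hurwitz q, forall i j, (size (Gh i j) <= size q)%N &
        forall i j, G i j = tofrac (Gh i j) / tofrac q].
Proof.
move=> GH; pose I := ('I_m * 'I_m)%type.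
pose q : {poly R} := \prod_(k : I) tf_den (G k.1 k.2).
have q0 : q != 0 by apply/prodf_neq0 => k _; exact: tf_den_neq0.
have dq i j : tf_den (G i j) %| q.
  by rewrite /q (bigD1 (i, j)) //= dvdp_mulr.
exists q, (\matrix_(i, j) (tf_num (G i j) * (q %/ tf_den (G i j)))).
have qE i j : q = tf_den (G i j) * (q %/ tf_den (G i j)).
  by rewrite mulrC divpK.
have r0 i j : q %/ tf_den (G i j) != 0.
  by apply: contraNneq q0 => e; rewrite (qE i j) e mulr0.
split=> //.
- move=> z; rewrite rmorph_prod rootE horner_prod => /prodf_eq0[k _].
  exact: (GH k.1 k.2).2.
- move=> i j; rewrite mxE {2}(qE i j).
  have [->|n0] := eqVneq (tf_num (G i j)) 0; first by rewrite mul0r size_poly0.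
  rewrite !size_mul ?tf_den_neq0 //; have [pr _] := GH i j.
  by rewrite -!subn1 leq_sub2r // leq_add2r.
- move=> i j; rewrite mxE {1}(tf_fracE (G i j)) tofracM.
  have -> : tofrac q = tofrac (tf_den (G i j)) * tofrac (q %/ tf_den (G i j)) :> tf R.
    by rewrite -tofracM -qE.
  have r0' : tofrac (q %/ tf_den (G i j)) != 0 :> tf R by rewrite tofrac_eq0 r0.
  by rewrite -mulf_div (divff r0') mulr1.
Qed.

End TransferFunctions.

(** * From nonsingularity to feedback stability *)

Section Feedback.
Context {R : realType}.
Local Notation toC := (real_complex R).
Local Notation "p ^C" := (map_poly toC p).

(* The frequency response at [w], and the response at infinity of a proper
   system, are instances of [A]. *)
Definition freq_limit {m : nat} (G : 'M[tf R]_m) (A : 'M[R[i]]_m) : Prop :=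
  forall e : R, 0 < e -> exists2 w : R, 0 <= w &
    forall i j, normc (freq_resp G w i j - A i j) <= e.

Lemma freq_limit_resp m (G : 'M[tf R]_m) w : 0 <= w ->
  freq_limit G (freq_resp G w).
Proof. by move=> w0 e e0; exists w => // i j; rewrite subrr normc0 ltW. Qed.

Lemma normc_imag_ge (w : R) : 0 <= w -> w <= normc (Complex 0 w).
Proof. by move=> w0; rewrite /= expr0n add0r sqrtr_sqr ger0_norm. Qed.

Lemma freq_limit_infty m (G : 'M[tf R]_m) (q : {poly R}) (Gh : 'M[{poly R}]_m) :
  q != 0 -> hurwitz q -> (forall i j, (size (Gh i j) <= size q)%N) ->
  (forall i j, G i j = tofrac (Gh i j) / tofrac q) ->
  freq_limit G (\matrix_(i, j) toC ((Gh i j)`_(size q).-1 / lead_coef q)).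
Proof.
move=> q0 qH sG GE e e0; set d := (size q).-1.
have sq : size q = d.+1 by rewrite /d prednK // size_poly_gt0.
have l0 : lead_coef q != 0 by rewrite lead_coef_eq0.
have qC0 : q^C != 0 by rewrite map_poly_eq0.
have [k k0 kP] := open_lhp_horner_ge _ qC0 qH.
(* Subtracting this multiple of [q] cancels the coefficient of degree [d], so the error [c / q]
   decays like [1 / |z|]. *)
pose c i j := Gh i j - ((Gh i j)`_d / lead_coef q) *: q.
have sc i j : (size (c i j) <= d)%N.
  apply/leq_sizeP => l; rewrite leq_eqVlt => /orP[/eqP <-|dl].
    by rewrite coefB coefZ [q`_d]lead_coefE divfK // subrr.
  have ql : (size q <= l)%N by rewrite sq.
  by rewrite coefB coefZ (nth_default _ ql) mulr0 subr0 nth_default // (leq_trans (sG i j)).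
pose M := \sum_(t : 'I_m * 'I_m * 'I_d) normc (toC (c t.1.1 t.1.2)`_t.2).
have M0 : 0 <= M by apply: sumr_ge0 => t _; exact: normc_ge0.
have cM i j l : (l < d)%N -> normc (c i j)^C`_l <= M.
  move=> ld; rewrite coef_map /M (bigD1 (i, j, Ordinal ld)) //= lerDl.
  by apply: sumr_ge0 => t _; exact: sqrtr_ge0.
have B0 : 0 <= d%:R * M / (k * e) by rewrite divr_ge0 ?mulr_ge0 // ltW.
(* At this frequency the error bound [d M / (k (1 + |z|))] is at most [e]. *)
exists (d%:R * M / (k * e)) => // i j; rewrite !mxE.
set w := d%:R * M / (k * e); set z := Complex 0 w.
have z0 : 0 <= complex.Re z by rewrite lexx.
have qz : ~~ root q^C z by apply/negP => /qH; rewrite /= ltxx.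
have nqz : 0 < normc q^C.[z] by rewrite lt0r normc_ge0 andbT normc_eq0.
rewrite (tf_evalE _ _ _ _ q0 (GE i j) qz).
have -> : (Gh i j)^C.[z] / q^C.[z] - toC ((Gh i j)`_d / lead_coef q)
        = (c i j)^C.[z] / q^C.[z].
  rewrite /c rmorphB /= map_polyZ hornerD hornerN hornerZ mulrBl.
  by rewrite mulfK.
rewrite normcM normcV ler_pdivrMr //.
have z1 : 0 < 1 + normc z by rewrite ltr_pwDl ?normc_ge0.
have h1 : normc (c i j)^C.[z] * (1 + normc z) <= d%:R * M * (1 + normc z) ^+ d.
  by apply: normc_horner_le; [rewrite size_map_poly|exact: cM].
have h2 := kP z z0; rewrite size_map_poly -/d in h2.
rewrite -(ler_pM2r z1); apply: le_trans h1 _.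
have s0 : 0 <= (1 + normc z) ^+ d by rewrite exprn_ge0 // ltW.
have wE : d%:R * M = w * (k * e) by rewrite divfK // gt_eqF ?mulr_gt0.
have zw : w <= 1 + normc z by apply: le_trans (normc_imag_ge _ B0) _; rewrite lerDr.
rewrite wE; apply: (@le_trans _ _ ((1 + normc z) * e * (k * (1 + normc z) ^+ d))).
  have -> : w * (k * e) * (1 + normc z) ^+ d = w * (e * (k * (1 + normc z) ^+ d)).
    by ring.
  rewrite -[X in _ <= X]mulrA ler_wpM2r // !mulr_ge0 // ltW //.
have -> : e * normc q^C.[z] * (1 + normc z) = (1 + normc z) * e * normc q^C.[z].
  by ring.
by rewrite ler_wpM2l // mulr_ge0 // ltW.
Qed.

(** Conjugation moves a root on the axis to a nonnegative frequency, the only kind that [freq_limit]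
    covers. *)
Lemma hurwitz_axis (p : {poly R}) w :
  root p^C (Complex 0 w) -> root p^C (Complex 0 `|w|).
Proof.
have [w0|w0 h] := leP 0 w; first by rewrite ger0_norm.
rewrite ltr0_norm // -[Complex _ _]/(conjc (Complex 0 w)) -complex_root_conj.
rewrite -map_poly_comp; suff -> : map_poly (conjc \o toC) p = p^C by [].
by apply: eq_map_poly => x /=; rewrite oppr0.
Qed.

Lemma feedback_stable_homotopy m (G : 'M[tf R]_m) (H : 'M[R]_m) : RHinf G ->
  (forall A t, freq_limit G A -> 0 <= t <= 1 ->
     1%:M + toC t *: (A *m map_mx toC H) \in unitmx) ->
  feedback_stable G H.
Proof.
move=> GH nonsing.
have [q [Gh [q0 qH sG GE]]] := RHinf_common_den _ G GH.
set d := (size q).-1.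
have sq : size q = d.+1 by rewrite /d prednK // size_poly_gt0.
pose GhH := Gh *m map_mx (@polyC R) H.
pose M t : 'M[{poly R}]_m := q%:M + t%:P *: GhH.
pose P t := \det (M t).
have sGhH i j : (size (GhH i j) <= d.+1)%N.
  rewrite mxE; apply: (big_ind (fun p : {poly R} => size p <= d.+1)%N).
  - by rewrite size_poly0.
  - by move=> a b sa sb; rewrite (leq_trans (size_polyD _ _)) // geq_max sa.
  - move=> k _; rewrite mxE mulrC mul_polyC.
    by rewrite (leq_trans (size_scale_leq _ _)) // -sq sG.
have sM t i j : (size (M t i j) <= d.+1)%N.
  rewrite /M {P M}; move: GhH sGhH => X sX.
  rewrite !mxE (leq_trans (size_polyD _ _)) // geq_max; apply/andP; split.
    by case: eqP => _; rewrite ?mulr1n ?mulr0n ?size_poly0 ?sq.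
  by rewrite mul_polyC (leq_trans (size_scale_leq _ _)).
have evM t z : map_mx (fun p => p^C.[z]) (M t) =
    (q^C.[z])%:M + toC t *: (map_mx (fun p => p^C.[z]) Gh *m map_mx toC H).
  apply/matrixP => i j; rewrite !mxE rmorphD hornerD rmorphM hornerM /=.
  rewrite map_polyC hornerC; congr (_ + _ * _).
    by case: eqP => _; rewrite ?mulr1n ?mulr0n ?rmorph0 ?horner0.
  rewrite rmorph_sum horner_sum; apply: eq_bigr => k _.
  by rewrite !mxE rmorphM hornerM /= map_polyC hornerC.
have evP t z : (P t)^C.[z] = \det (map_mx (fun p => p^C.[z]) (M t)).
  rewrite -[LHS]/((horner_eval z \o map_poly toC) (P t)) /P -det_map_mx.
  by congr (\det _); apply/matrixP => i j; rewrite !mxE.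
(* On the axis [P t] equals [q^m det (I + t G H)], and [q] does not vanish there. *)
have axisP t w : 0 <= t <= 1 -> ~~ root (P t)^C (Complex 0 w).
  move=> t01; apply/negP => /hurwitz_axis; set z := Complex 0 _.
  have qz : q^C.[z] != 0.
    by apply/negP => /qH; rewrite /= ltxx.
  rewrite /root evP evM.
  have -> : map_mx (fun p => p^C.[z]) Gh = q^C.[z] *: freq_resp G `|w|.
    apply/matrixP => i j; rewrite !mxE (tf_evalE _ _ _ _ q0 (GE i j) qz).
    by rewrite mulrC divfK.
  rewrite -scalemxAl scalerA mulrC -scalerA -scalemx1 -scalerDr detZ mulf_eq0.
  rewrite expf_eq0 (negPf qz) andbF /=.
  have := nonsing _ t (freq_limit_resp _ G _ (normr_ge0 w)) t01.
  by rewrite unitmxE unitfE => /negPf ->.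
(* The coefficient of degree [m * d] is [(lead_coef q)^m det (I + t A H)], with [A] the response at
   infinity. *)
have sizeP t : 0 <= t <= 1 -> size (P t) = (m * d).+1.
  move=> t01; have [sz coefE] := det_coef _ (M t) d (sM t).
  apply/eqP; rewrite eqn_leq sz ltnNge; apply/negP => /leq_sizeP /(_ _ (leqnn _)).
  rewrite coefE => /(congr1 toC); rewrite rmorph0 -det_map_mx -map_mx_comp.
  have lq0 : toC (lead_coef q) != 0 by rewrite fmorph_eq0 lead_coef_eq0.
  have := nonsing _ t (freq_limit_infty _ G q Gh q0 qH sG GE) t01.
  rewrite unitmxE unitfE; set A := (\matrix_(i, j) _).
  move=> /negPf nz; have -> : map_mx (toC \o (fun p : {poly R} => p`_d)) (M t) =
     toC (lead_coef q) *: (1%:M + toC t *: (A *m map_mx toC H)).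
    apply/matrixP => i j; rewrite !mxE /comp coefD coefCM rmorphD rmorphM mulrDr.
    congr (_ + _).
      rewrite /= lead_coefE -/d.
      by case: eqP => _; rewrite ?mulr1n ?mulr0n ?mulr1 ?mulr0 ?coef0.
    rewrite mulrCA; congr (_ * _); rewrite coef_sum rmorph_sum mulr_sumr.
    apply: eq_bigr => k _; rewrite !mxE coefMC rmorphM mulrA; congr (_ * _).
    by rewrite -rmorphM [lead_coef q * _]mulrC divfK // lead_coef_eq0.
  by move/eqP; rewrite detZ mulf_eq0 nz expf_eq0 (negPf lq0) andbF.
(* The outer variable is [s] and the inner one is [t], so each coefficient of [B] is a polynomial in
   [t], as the homotopy requires. *)
pose B : {poly {poly R}} :=
  \det ((map_poly (@polyC R) q)%:M + ('X)%:P *: map_mx (map_poly (@polyC R)) GhH).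
have PB t i : (P t)`_i = (B`_i).[t].
  rewrite -[RHS]/(horner_eval t B`_i) -coef_map.
  suff -> : P t = map_poly (horner_eval t) B by [].
  rewrite /B -[RHS]det_map_mx /P; congr (\det _); apply/matrixP => k l.
  have polyCK (p : {poly R}) : map_poly (horner_eval t) (map_poly (@polyC R) p) = p.
    by rewrite -map_poly_comp map_poly_id // => x _; rewrite /= /horner_eval hornerC.
  rewrite /M; move: (GhH) => X; rewrite !mxE rmorphD rmorphM rmorphMn.
  by rewrite /= !polyCK map_polyC /= /horner_eval hornerX.
have P0 : hurwitz (P 0).
  move=> z; rewrite /P /M scale0r addr0 det_scalar rmorphXn rootE horner_exp.
  by rewrite expf_eq0 => /andP[_ /qH].
have P1 : hurwitz (P 1) by apply: (hurwitz_homotopy _ _ _ PB sizeP axisP P0).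
have s1 : size (P 1) = (m * d).+1 by apply: sizeP; rewrite ler01 lexx.
have P1n0 : P 1 != 0 by rewrite -size_poly_eq0 s1.
have tP1n0 : tofrac (P 1) != 0 :> tf R by rewrite tofrac_eq0.
have tqn0 : tofrac q != 0 :> tf R by rewrite tofrac_eq0.
rewrite /feedback_stable; set S := 1%:M + _.
have SE : tofrac q *: S = map_mx (@tofrac _) (M 1).
  apply/matrixP => i j; rewrite !mxE mul1r tofracD mulrDr; congr (_ + _).
    by case: eqP => _; rewrite ?mulr1n ?mulr0n ?mulr1 ?mulr0 ?tofrac0.
  rewrite rmorph_sum mulr_sumr; apply: eq_bigr => k _.
  by rewrite !mxE GE rmorphM /= mulrA [tofrac q * _]mulrC divfK.
(* Cramer's rule: [S = M 1 / q], so its inverse is [q adj (M 1) / P 1], with poles among the roots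
   of [P 1]. *)
pose T := (tofrac q / tofrac (P 1)) *: map_mx (@tofrac _) (\adj (M 1)).
have ST : S *m T = 1%:M.
  rewrite /T -scalemxAr -[tofrac q / _]mulrC -scalerA scalemxAl SE -map_mxM.
  rewrite mul_mx_adj -/(P 1) map_scalar_mx scale_scalar_mx.
  by rewrite (mulVf tP1n0).
have [Su _] := mulmx1_unit ST; split=> //.
have -> : invmx S = T by rewrite -[LHS]mulmx1 -ST mulKmx.
have TE i j : T i j = tofrac (q * (\adj (M 1)) i j) / tofrac (P 1).
  by rewrite /T mxE [in LHS]mxE tofracM mulrAC.
move=> i j; split; last first.
  move=> z; rewrite /is_pole => rz; apply: P1.
  by apply: root_dvdp rz; rewrite dvdp_map (tf_den_dvd _ _ _ P1n0 (TE i j)).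
(* Cofactors have degree at most [(m - 1) d] and [q] adds [d], which matches the exact degree [m d]
   of [P 1]. The index [i] provides [m > 0]. *)
apply: (tf_properP _ _ _ P1n0 (TE i j)).
rewrite s1 mxE /cofactor mulrCA size_Msign.
apply: leq_trans (size_polyMleq _ _) _.
have [|+ _] := det_coef _ (row' j (col' i (M 1))) d.
  by move=> k l; rewrite 2!mxE; exact: sM.
rewrite sq addSn /= => sz; apply: leq_trans (leq_add (leqnn d) sz) _.
by rewrite addnS ltnS -mulSn prednK // (leq_ltn_trans _ (ltn_ord i)).
Qed.

End Feedback.

(** * Real inner products and spectra *)

Section RealInnerProduct.
Context {R : realType}.
Local Notation toC := (real_complex R).

(* The real inner product underlying the Hermitian one. *)
Definition rdot {n} (v w : 'cV[R[i]]_n) : R := complex.Re ((v^t* *m w) 0 0).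

Lemma rdotE n (v w : 'cV[R[i]]_n) : rdot v w =
  \sum_k (complex.Re (v k 0) * complex.Re (w k 0)
         + complex.Im (v k 0) * complex.Im (w k 0)).
Proof.
rewrite /rdot mxE raddf_sum; apply: eq_bigr => k _; rewrite !mxE.
by case: (v k 0) (w k 0) => [a b] [c d] /=; ring.
Qed.

Lemma enorm_sqr n (v : 'cV[R[i]]_n) : enorm v ^+ 2 = rdot v v.
Proof.
rewrite /enorm sqr_sqrtr ?rdotE; first by apply: eq_bigr => k _; rewrite -!expr2.
by apply: sumr_ge0 => k _; rewrite addr_ge0 ?sqr_ge0.
Qed.

Lemma rdot_normc n (v : 'cV[R[i]]_n) : rdot v v = \sum_k normc (v k 0) ^+ 2.
Proof. by rewrite rdotE; apply: eq_bigr => k _; rewrite normc_sqr -!expr2. Qed.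

Lemma rdot_ge0 n (v : 'cV[R[i]]_n) : 0 <= rdot v v.
Proof. by rewrite rdot_normc sumr_ge0 // => k _; rewrite sqr_ge0. Qed.

Lemma rdot_eq0 n (v : 'cV[R[i]]_n) : (rdot v v == 0) = (v == 0).
Proof.
apply/eqP/eqP => [|->]; last by rewrite /rdot mulmx0 mxE.
rewrite rdot_normc => /eqP; rewrite psumr_eq0; last by move=> k _; rewrite sqr_ge0.
move=> /allP h; apply/matrixP => k j; rewrite ord1 mxE; apply/eqP.
by have := h k (mem_index_enum _); rewrite /= expf_eq0 /= normc_eq0.
Qed.

Lemma rdotC n (v w : 'cV[R[i]]_n) : rdot v w = rdot w v.
Proof.
by rewrite !rdotE; apply: eq_bigr => k _; congr (_ + _); rewrite mulrC.
Qed.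

Lemma rdotDr n (v w x : 'cV[R[i]]_n) : rdot v (w + x) = rdot v w + rdot v x.
Proof. by rewrite /rdot mulmxDr mxE raddfD. Qed.

Lemma rdotZr n a (v w : 'cV[R[i]]_n) : rdot v (toC a *: w) = a * rdot v w.
Proof.
by rewrite /rdot -scalemxAr mxE; case: (_ 0 0) => c d /=; rewrite mul0r subr0.
Qed.

Lemma rdotZl n a (v w : 'cV[R[i]]_n) : rdot (toC a *: v) w = a * rdot v w.
Proof. by rewrite rdotC rdotZr rdotC. Qed.

Lemma rdot_isometry n (U : 'M[R[i]]_n) v w : U^t* *m U = 1%:M ->
  rdot (U *m v) (U *m w) = rdot v w.
Proof.
move=> UU; rewrite /rdot trmx_mul map_mxM -mulmxA [_^t* *m (U *m w)]mulmxA UU.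
by rewrite mul1mx.
Qed.

(** Expands the nonnegative square of [w - (rdot v w) v]. *)
Lemma rdot_cauchy n (v w : 'cV[R[i]]_n) : rdot v v = 1 ->
  rdot v w ^+ 2 <= rdot w w.
Proof.
move=> v1; have := rdot_ge0 _ (w + toC (- rdot v w) *: v).
rewrite rdotDr [rdot _ w]rdotC [rdot _ (_ *: _)]rdotC !rdotDr !(rdotZl, rdotZr).
by rewrite v1 [rdot w v]rdotC; move: (rdot v w) (rdot w w) => x y; nra.
Qed.

Lemma rdot_mxcol (p : nat) (n : 'I_p -> nat) (v w : forall i, 'cV[R[i]]_(n i)) :
  rdot (\mxcol_i v i) (\mxcol_i w i) = \sum_i rdot (v i) (w i).
Proof.
rewrite /rdot tr_mxcol.
have -> : map_mx Num.conj (\mxrow_i (v i)^T) = \mxrow_i (v i)^t*.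
  by apply/matrixP => i j; rewrite !mxE.
by rewrite mul_mxrow_mxcol summxE raddf_sum.
Qed.

Lemma xz_graphE n (A : 'M[R[i]]_n) v : rdot v v = 1 ->
  xz_graph A (rdot v (A *m v), rdot (A *m v) (A *m v)).
Proof.
move=> v1; exists v.
  by rewrite -[enorm v]ger0_norm ?sqrtr_ge0 // -sqrtr_sqr enorm_sqr v1 sqrtr1.
by rewrite -enorm_sqr /rdot mulmxA.
Qed.

End RealInnerProduct.

(** * Spectral decomposition of a real symmetric matrix *)

Section SymmetricSpectrum.
Context {R : realType}.
Local Notation toC := (real_complex R).

(* [rdot (K v) (K v) - (l1 + l2) rdot v (K v) + l1 l2 rdot v v] is the form of
   (K - l1)(K - l2), which is nonpositive when the spectrum lies in [l1, l2];
   the last clause realises the chord joining (l1, l1^2) to (l2, l2^2). *)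
Lemma sym_spectral_chord m (K : 'M[R]_m) : (0 < m)%N -> K^T = K ->
  exists l1 l2 : R,
  [/\ l1 <= l2,
      forall v, rdot (map_mx toC K *m v) (map_mx toC K *m v)
                - (l1 + l2) * rdot v (map_mx toC K *m v) + l1 * l2 * rdot v v <= 0 &
      forall a b, 0 <= a -> 0 <= b -> a + b = 1 -> exists v,
        [/\ rdot v v = 1, rdot v (map_mx toC K *m v) = a * l1 + b * l2 &
            rdot (map_mx toC K *m v) (map_mx toC K *m v) = a * l1 ^+ 2 + b * l2 ^+ 2]].
Proof.
move=> m0 Ksym; set Kc := map_mx toC K.
have Kherm : Kc \is hermsymmx.
  apply: realsym_hermsym.
    apply/is_hermitianmxP; rewrite expr0 scale1r map_mx_id //.
    by rewrite /Kc map_trmx Ksym.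
  by apply/mxOverP => i j; rewrite mxE; apply/complex_realP; exists (K i j).
have /hermitian_normalmx /orthomx_spectralP := Kherm.
have := hermitian_spectral_diag_real Kherm.
have := spectral_unitarymx Kc.
move: (spectralmx Kc) (spectral_diag Kc) => U dg Uu dgR.
rewrite (invmx_unitary Uu) => KE.
have UU : U *m U^t* = 1%:M by apply/unitarymxP.
have UU' : U^t* *m U = 1%:M by apply: mulmx1C.
pose l k := complex.Re (dg 0 k).
have lE k : dg 0 k = toC (l k).
  by have /mxOverP /(_ 0 k) /complex_realP [x xE] := dgR; rewrite /l xE.
have UK v k : (U *m (Kc *m v)) k 0 = toC (l k) * (U *m v) k 0.
  rewrite {1}KE -!mulmxA [U *m (_ *m _)]mulmxA UU mul1mx.
  by rewrite mul_diag_mx mxE lE.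
have rK v : rdot v (Kc *m v) = \sum_k l k * normc ((U *m v) k 0) ^+ 2.
  rewrite -(rdot_isometry _ U) // rdotE; apply: eq_bigr => k _.
  by rewrite !UK; case: ((U *m v) k 0) => x y; rewrite normc_sqr /=; ring.
have rKK v : rdot (Kc *m v) (Kc *m v) = \sum_k l k ^+ 2 * normc ((U *m v) k 0) ^+ 2.
  rewrite -(rdot_isometry _ U) // rdotE; apply: eq_bigr => k _.
  by rewrite !UK; case: ((U *m v) k 0) => x y; rewrite normc_sqr /=; ring.
have rv v : rdot v v = \sum_k normc ((U *m v) k 0) ^+ 2.
  by rewrite -(rdot_isometry _ U) // rdot_normc.
have [k1 _ k1P] := @Order.TotalTheory.arg_minP _ _ _ (Ordinal m0) xpredT l isT.
have [k2 _ k2P] := @Order.TotalTheory.arg_maxP _ _ _ (Ordinal m0) xpredT l isT.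
exists (l k1), (l k2); split; first exact: k1P.
  move=> v; rewrite rK rKK rv !mulr_sumr -sumrB -big_split /=.
  apply: sumr_le0 => k _; have h1 := k1P k isT; have h2 := k2P k isT.
  move: (normc _ ^+ 2) (sqr_ge0 (normc ((U *m v) k 0))) => N N0.
  have -> : l k ^+ 2 * N - (l k1 + l k2) * (l k * N) + l k1 * l k2 * N
          = (l k - l k1) * (l k - l k2) * N by ring.
  by rewrite mulr_le0_ge0 // mulr_ge0_le0 // ?subr_ge0 ?subr_le0.
move=> a b a0 b0 ab.
(* Weights of the sought vector in the eigenbasis; written as a sum so that [k1 = k2] gives the
   weight [a + b]. *)
pose c k : R := a *+ (k == k1) + b *+ (k == k2).
have c0 k : 0 <= c k by rewrite addr_ge0 ?mulrn_wge0.
pose w : 'cV[R[i]]_m := \col_k toC (Num.sqrt (c k)).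
have wE k : normc ((U *m (U^t* *m w)) k 0) ^+ 2 = c k.
  by rewrite mulmxA UU mul1mx mxE normc_real ger0_norm ?sqrtr_ge0 // sqr_sqrtr.
have csum (f : 'I_m -> R) : \sum_k f k * c k = a * f k1 + b * f k2.
  have pick k0 (x : R) : \sum_k f k * (x *+ (k == k0)) = x * f k0.
    rewrite (bigD1 k0) //= eqxx mulr1n big1 ?addr0 1?mulrC // => k /negPf ->.
    by rewrite mulr0n mulr0.
  by under eq_bigr do rewrite mulrDr; rewrite big_split /= !pick.
exists (U^t* *m w); split.
- rewrite rv; under eq_bigr do rewrite wE -[c _]mul1r.
  by rewrite (csum (fun=> 1)) !mulr1.
- by rewrite rK; under eq_bigr do rewrite wE; rewrite csum.
- by rewrite rKK; under eq_bigr do rewrite wE; rewrite (csum (fun k => l k ^+ 2)).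
Qed.

End SymmetricSpectrum.

(** * The decentralized margin *)

Section Margin.
Context {R : realType}.
Local Notation toC := (real_complex R).

(** As a quadratic in [t] the expression is convex and nonpositive at [t], so it has a root
    [t' >= t]. There [(x, z)] lies on the line through the points [(- t' l, t'^2 l^2)] with
    [l = l1, l2], and [x^2 <= z] places it between them. *)
Lemma chord_param (l1 l2 x z t : R) : 0 < l1 -> l1 <= l2 -> 0 < t ->
  x ^+ 2 <= z -> z + (l1 + l2) * t * x + l1 * l2 * t ^+ 2 <= 0 ->
  exists t' a b, [/\ t <= t', 0 <= a, 0 <= b, a + b = 1 &
    x = - t' * (a * l1 + b * l2) /\ z = t' ^+ 2 * (a * l1 ^+ 2 + b * l2 ^+ 2)].
Proof.
move=> l10 l12 t0 xz ht; have l20 : 0 < l2 := lt_le_trans l10 l12.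
set s := l1 + l2; set q := l1 * l2; have q0 : 0 < q by rewrite mulr_gt0.
(* The discriminant of the quadratic in [t]; [t'] below is the larger root. *)
pose D := s ^+ 2 * x ^+ 2 - 4 * q * z.
have hD : (2 * q * t + s * x) ^+ 2 <= D.
  have -> : D = (2 * q * t + s * x) ^+ 2 - 4 * q * (z + s * t * x + q * t ^+ 2).
    by rewrite /D; ring.
  by rewrite lerBrDr gerDl mulr_ge0_le0 // mulr_ge0 // ltW.
have D0 : 0 <= D := le_trans (sqr_ge0 _) hD.
pose r := Num.sqrt D; have r2 : r ^+ 2 = D by rewrite sqr_sqrtr.
have hr : 2 * q * t + s * x <= r.
  rewrite /r; apply: le_trans (ler_norm _) _.
  by rewrite -sqrtr_sqr ler_wsqrtr.
pose t' := (r - s * x) / (2 * q).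
have q2 : 0 < 2 * q by rewrite mulr_gt0.
have tt' : t <= t' by rewrite /t' ler_pdivlMr //; lra.
have t'0 : 0 < t' := lt_le_trans t0 tt'.
have rE : r = 2 * q * t' + s * x by rewrite /t' mulrC divfK ?gt_eqF // subrK.
have zE : z = - s * t' * x - q * t' ^+ 2.
  have : 4 * q * (z + s * t' * x + q * t' ^+ 2) = 0.
    have -> : 4 * q * (z + s * t' * x + q * t' ^+ 2) = (2 * q * t' + s * x) ^+ 2 - D.
      by rewrite /D; ring.
    by rewrite -rE r2 subrr.
  move/eqP; rewrite mulf_eq0 mulf_eq0 (gt_eqF q0) pnatr_eq0 /= => /eqP; lra.
pose y := - x / t'.
have xE : x = - t' * y by rewrite /y !mulNr mulrN opprK mulrC divfK // gt_eqF.
have hy : (y - l1) * (y - l2) <= 0.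
  rewrite -(pmulr_rle0 _ (exprn_gt0 2 t'0)).
  have -> : t' ^+ 2 * ((y - l1) * (y - l2)) = x ^+ 2 - z.
    by rewrite zE xE /s /q; ring.
  by rewrite subr_le0.
(* Here the chord degenerates to a point, and the general weights would divide by zero. *)
have [e|ne] := eqVneq l1 l2.
  have ye : y = l1.
    by apply/eqP; rewrite -subr_eq0 -sqrf_eq0 eq_le sqr_ge0 andbT expr2 {2}e.
  exists t', 1, 0; split; rewrite ?addr0 //; split.
    by rewrite xE ye; ring.
  by rewrite zE xE /s /q -e ye; ring.
have l12' : 0 < l2 - l1 by rewrite subr_gt0 lt_neqAle ne.
have l12n : l2 - l1 != 0 by rewrite gt_eqF.
have y1 : l1 <= y by rewrite leNgt; apply/negP => yl; nra.
have y2 : y <= l2 by rewrite leNgt; apply/negP => yl; nra.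
have yE : y = (l2 - y) / (l2 - l1) * l1 + (y - l1) / (l2 - l1) * l2 by field.
exists t', ((l2 - y) / (l2 - l1)), ((y - l1) / (l2 - l1)); split => //.
- by rewrite divr_ge0 ?subr_ge0 // ltW.
- by rewrite divr_ge0 ?subr_ge0 // ltW.
- by field.
- split; first by rewrite -yE.
  by rewrite zE xE /s /q; field.
Qed.

Definition network_graph {m : nat} (H : 'M[R]_m) : set (R * R) :=
  \bigcup_(tau in [set tau : R | 0 < tau <= 1])
     xz_graph (map_mx toC (- tau^-1 *: invmx H)).

Lemma sym_posdef_unit m (H : 'M[R]_m) : sym_posdef H -> H \in unitmx.
Proof.
move=> [Hs Hp]; rewrite unitmxE unitfE; apply/negP => /det0P[v v0 vH].
have : v^T != 0 by rewrite -trmx0 (inj_eq trmx_inj).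
by move=> /Hp; rewrite trmxK vH mul0mx mxE ltxx.
Qed.

Lemma rdot_posdef m (H : 'M[R]_m) (y : 'cV[R[i]]_m) : sym_posdef H -> y != 0 ->
  0 < rdot y (map_mx toC H *m y).
Proof.
move=> [_ Hp] y0.
pose a := map_mx (@complex.Re R) y; pose b := map_mx (@complex.Im R) y.
have -> : rdot y (map_mx toC H *m y) = (a^T *m H *m a) 0 0 + (b^T *m H *m b) 0 0.
  rewrite rdotE -!mulmxA !mxE -big_split /=; apply: eq_bigr => k _.
  rewrite !mxE !raddf_sum; congr (_ * _ + _ * _); apply: eq_bigr => j _;
    by rewrite !mxE; case: (y j 0) => u v /=; ring.
have nneg (c : 'cV[R]_m) : 0 <= (c^T *m H *m c) 0 0.
  have [->|c0] := eqVneq c 0; first by rewrite mulmx0 mxE.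
  by rewrite ltW // Hp.
have [a0|a0] := eqVneq a 0; last by rewrite ltr_pwDl // Hp.
rewrite ltr_wpDl //; apply: Hp; apply: contraNneq y0 => b0.
apply/eqP/matrixP => k j; rewrite mxE.
move/matrixP: a0 => /(_ k j); move/matrixP: b0 => /(_ k j); rewrite !mxE.
by case: (y k j) => u v /= -> ->.
Qed.

Lemma rdot_posdef_inv m (H : 'M[R]_m) (v : 'cV[R[i]]_m) : sym_posdef H -> v != 0 ->
  0 < rdot v (map_mx toC (invmx H) *m v).
Proof.
move=> Hs v0; have Hu := sym_posdef_unit _ _ Hs.
set y := map_mx toC (invmx H) *m v.
have vE : v = map_mx toC H *m y by rewrite /y mulmxA -map_mxM mulmxV // map_mx1 mul1mx.
rewrite vE rdotC; apply: rdot_posdef => //.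
by apply: contraNneq v0 => y0; rewrite vE y0 mulmx0.
Qed.

(** Here [s = l1 + l2] and [q = l1 l2] for the extreme eigenvalues of [H^-1]. The spectral
    inequality and the membership criterion share these coefficients, so the two can be opposed at a
    singular point. *)
Lemma network_spectrum m (H : 'M[R]_m) : (0 < m)%N -> sym_posdef H ->
  exists s q : R,
  (forall v, rdot (map_mx toC (invmx H) *m v) (map_mx toC (invmx H) *m v)
                - s * rdot v (map_mx toC (invmx H) *m v) + q * rdot v v <= 0) /\
  (forall x z t, 1 <= t -> x ^+ 2 <= z -> z + s * t * x + q * t ^+ 2 <= 0 ->
     network_graph H (x, z)).
Proof.
move=> m0 Hs; have [Hsym _] := Hs.
have Ksym : (invmx H)^T = invmx H by rewrite trmx_inv Hsym.
have [l1 [l2 [l12 hK chord]]] := sym_spectral_chord _ _ m0 Ksym.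
have l10 : 0 < l1.
  (* The weights 1 and 0 give a unit vector at which the form of [H^-1] equals [l1]. *)
  have [v [v1 vK _]] := chord 1 0 ler01 (lexx 0) (addr0 1).
  rewrite mul1r mul0r addr0 in vK; rewrite -vK; apply: rdot_posdef_inv => //.
  by rewrite -rdot_eq0 v1 oner_eq0.
exists (l1 + l2), (l1 * l2); split => // x z t t1 xz h.
have t0 : 0 < t := lt_le_trans ltr01 t1.
have [t' [a [b [tt' a0 b0 ab [xE zE]]]]] := chord_param _ _ _ _ _ l10 l12 t0 xz h.
have t'1 : 1 <= t' := le_trans t1 tt'.
have t'0 : 0 < t' := lt_le_trans t0 tt'.
have [v [v1 vK vKK]] := chord a b a0 b0 ab.
exists t'^-1; first by rewrite /= invr_gt0 t'0 invf_le1.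
have := @xz_graphE _ _ (map_mx toC (- t'^-1^-1 *: invmx H)) v v1.
rewrite invrK map_mxZ -scalemxAl !(rdotZr, rdotZl) vK vKK.
by rewrite -xE mulrA mulrNN -expr2 -zE.
Qed.

(** * Passage of the margin to limits of the frequency response *)

Lemma rdot_le n (a u : 'cV[R[i]]_n) (M : R) : (forall k, normc (u k 0) <= M) ->
  `|rdot a u| <= M * \sum_k normc (a k 0).
Proof.
move=> uM; rewrite /rdot; apply: le_trans (ler_Re_normc _) _.
rewrite mxE mulr_sumr; apply: le_trans (normc_sum _ _ _ _) _.
apply: ler_sum => k _; rewrite !mxE normcM mulrC.
have -> : normc (Num.conj (a k 0)) = normc (a k 0).
  by case: (a k 0) => x y /=; rewrite sqrrN.
by rewrite ler_wpM2r ?normc_ge0.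
Qed.

Lemma edist2_le (p p' : R * R) : edist2 p p' <= `|p.1 - p'.1| + `|p.2 - p'.2|.
Proof.
rewrite /edist2 -[X in _ <= X]ger0_norm ?addr_ge0 // -sqrtr_sqr ler_wsqrtr //.
by rewrite [X in _ <= X]sqrrD !real_normK ?num_real // lerD2r lerDl mulrn_wge0 //.
Qed.

Lemma xz_limit n (G : 'M[tf R]_n) A v (e : R) : freq_limit G A -> 0 < e ->
  exists2 w : R, 0 <= w &
    edist2 (rdot v (freq_resp G w *m v),
            rdot (freq_resp G w *m v) (freq_resp G w *m v))
           (rdot v (A *m v), rdot (A *m v) (A *m v)) < e.
Proof.
move=> GA e0; set a := A *m v.
pose L := \sum_k normc (v k 0); pose La := \sum_k normc (a k 0).
have L0 : 0 <= L by apply: sumr_ge0 => k _; exact: normc_ge0.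
have La0 : 0 <= La by apply: sumr_ge0 => k _; exact: normc_ge0.
(* When entries move by at most [d <= 1], the first coordinate moves by at most [d L^2] and the
   second by at most [d L (2 La + n L)]; [d <= 1] absorbs the quadratic term. *)
pose C := L * L + L * (2 * La + n%:R * L).
have C0 : 0 <= C by rewrite !(addr_ge0, mulr_ge0).
pose d := Num.min 1 (e / (C + 1)).
have C1 : 0 < C + 1 by rewrite ltr_wpDl.
have d0 : 0 < d by rewrite lt_min ltr01 divr_gt0.
have d1 : d <= 1 by rewrite ge_min lexx.
have de : d * (C + 1) <= e by rewrite -ler_pdivlMr // ge_min lexx orbT.
have [w w0 wP] := GA d d0; exists w => //; set B := freq_resp G w in wP *.
apply: le_lt_trans (edist2_le _ _) _ => /=.
pose u := (B - A) *m v.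
have BE : B *m v = a + u by rewrite /u mulmxBl addrC subrK.
have uM k : normc (u k 0) <= d * L.
  rewrite mxE mulr_sumr; apply: le_trans (normc_sum _ _ _ _) _.
  apply: ler_sum => j _; rewrite normcM ler_wpM2r ?normc_ge0 //.
  by rewrite !mxE; have := wP k j; rewrite !mxE.
have hv := rdot_le _ v u _ uM; have ha := rdot_le _ a u _ uM.
have hu := rdot_le _ u u _ uM.
rewrite BE rdotDr.
have -> : rdot v a + rdot v u - rdot v a = rdot v u by rewrite addrAC subrr add0r.
rewrite rdotDr [rdot (a + u) a]rdotC [rdot (a + u) u]rdotC.
rewrite !rdotDr [rdot u a]rdotC.
have -> : rdot a a + rdot a u + (rdot a u + rdot u u) - rdot a a
        = 2 * rdot a u + rdot u u.
  by move: (rdot a a) (rdot a u) (rdot u u) => *; ring.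
have su : \sum_k normc (u k 0) <= n%:R * (d * L).
  rewrite mulr_natl -[n in X in _ <= X]card_ord -sumr_const.
  by apply: ler_sum => k _.
have hu' : `|rdot u u| <= d * L * (n%:R * L).
  apply: le_trans hu _; apply: ler_wpM2l; first by rewrite mulr_ge0 // ltW.
  by apply: le_trans su _; rewrite ler_wpM2l // ler_piMl.
have h2 : `|2 * rdot a u + rdot u u| <= 2 * (d * L * La) + d * L * (n%:R * L).
  apply: le_trans (ler_normD _ _) _; apply: lerD hu'.
  by rewrite normrM ger0_norm // ler_wpM2l.
apply: le_lt_trans (lerD hv h2) _.
apply: lt_le_trans de; rewrite mulrDr mulr1.
have -> : d * L * L + (2 * (d * L * La) + d * L * (n%:R * L)) = d * C.
  by rewrite /C; ring.
by rewrite ltrDl.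
Qed.

Lemma set_dist_gt0 (A B : set (R * R)) : (0 < set_dist A B)%E ->
  exists2 d : R, 0 < d & forall a b, A a -> B b -> d <= edist2 a b.
Proof.
move=> AB0; have le_d a b : A a -> B b -> (set_dist A B <= (edist2 a b)%:E)%E.
  by move=> Aa Bb; apply: ereal_inf_lbound; exists a => //; exists b.
case: (set_dist A B) AB0 le_d => [r r0 le_d||] //.
  by exists r => [|a b Aa Bb]; rewrite -?lte_fin // -lee_fin le_d.
(* An infinite distance means that one of the sets is empty, so any [d] serves. *)
by move=> _ le_d; exists 1 => // a b Aa /(le_d _ _ Aa).
Qed.

(** The limit [A] may be attained at no frequency, as with the response at infinity. Its point is
    approached by graph points at actual frequencies, eventually nearer than the margin permits. *)
Lemma margin_limit m n (H : 'M[R]_m) (G : 'M[tf R]_n) A v :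
  (0 < set_dist (\bigcup_(w in [set w : R | (0 <= w)%R]) xz_graph (freq_resp G w))
                (network_graph H))%E ->
  freq_limit G A -> rdot v v = 1 ->
  ~ network_graph H (rdot v (A *m v), rdot (A *m v) (A *m v)).
Proof.
move=> /set_dist_gt0[d d0 dP] GA v1 SA.
have [w w0] := xz_limit _ _ _ v _ GA d0; rewrite ltNge => /negP; apply.
by apply: dP => //; exists w => //; exact: xz_graphE.
Qed.

End Margin.

(** * Block-diagonal systems *)

Section Decentralized.
Context {R : realType}.
Local Notation toC := (real_complex R).

Lemma tf_eval0 (z : R[i]) : tf_eval (0 : tf R) z = 0.
Proof.
have e : (0 : tf R) = tofrac 0 / tofrac 1 by rewrite tofrac0 mul0r.
have := @tf_cross _ _ _ _ (oner_neq0 {poly R}) e; rewrite mulr1 mul0r => n0.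
by rewrite /tf_eval n0 rmorph0 horner0 mul0r.
Qed.

(** The off-diagonal blocks vanish at every frequency, hence also in the limit. *)
Lemma freq_limit_mxdiag (N : nat) (n : 'I_N -> nat)
    (G : forall i, 'M[tf R]_(n i)) (A : 'M[R[i]]_(\sum_i n i)) :
  freq_limit (\mxdiag_i G i) A ->
  exists2 D : forall i, 'M[R[i]]_(n i),
    A = \mxdiag_i D i & forall i, freq_limit (G i) (D i).
Proof.
move=> GA; exists (fun i => submxblock A i i).
  apply/mxblockP => i j; rewrite mxblockK.
  have [<-|ij] := eqVneq i j; first by rewrite conform_mx_id.
  apply/matrixP => k l; rewrite [RHS]mxE; apply/eqP.
  rewrite -normc_eq0 eq_le normc_ge0 andbT; apply/ler_addgt0Pr => e e0.
  have [w w0 /(_ (tagnat.Rank i k) (tagnat.Rank j l))] := GA e e0.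
  rewrite add0r [A _ _ in X in X -> _](_ : _ = submxblock A i j k l); last by rewrite mxE.
  rewrite mxE.
  have -> : (\mxdiag_i G i) (tagnat.Rank i k) (tagnat.Rank j l)
          = submxblock (\mxdiag_i G i) i j k l by rewrite [RHS]mxE.
  by rewrite mxblockK (negPf ij) mxE tf_eval0 sub0r normcN.
move=> i e e0; have [w w0 wP] := GA e e0; exists w => // k l.
have := wP (tagnat.Rank i k) (tagnat.Rank i l).
have <- : submxblock (freq_resp (\mxdiag_i G i) w) i i k l
        = freq_resp (\mxdiag_i G i) w (tagnat.Rank i k) (tagnat.Rank i l).
  by rewrite mxE.
have <- : submxblock A i i k l = A (tagnat.Rank i k) (tagnat.Rank i l).
  by rewrite mxE.
suff -> : submxblock (freq_resp (\mxdiag_i G i) w) i i = freq_resp (G i) w by [].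
rewrite -[in RHS](submxblock_diag G i).
by move: (\mxdiag_i G i) => X; apply/matrixP => a b; rewrite !mxE.
Qed.

(** The form is homogeneous, so [u] may be normalised. At a unit vector Cauchy-Schwarz supplies
    [x^2 <= z], and a nonpositive value would put the point in [S]. *)
Lemma block_form_gt0 n (A : 'M[R[i]]_n) (s q t : R) (S : set (R * R)) u :
  1 <= t ->
  (forall x z t, 1 <= t -> x ^+ 2 <= z -> z + s * t * x + q * t ^+ 2 <= 0 ->
     S (x, z)) ->
  (forall v, rdot v v = 1 -> ~ S (rdot v (A *m v), rdot (A *m v) (A *m v))) ->
  u != 0 ->
  0 < rdot (A *m u) (A *m u) + s * t * rdot u (A *m u) + q * t ^+ 2 * rdot u u.
Proof.
move=> t1 inS notS u0.
have ru0 : 0 < rdot u u by rewrite lt0r rdot_eq0 u0 rdot_ge0.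
set r := Num.sqrt (rdot u u).
have r0 : 0 < r by rewrite sqrtr_gt0.
have r2 : r ^+ 2 = rdot u u by rewrite sqr_sqrtr // ltW.
pose v := toC r^-1 *: u.
have uE : u = toC r *: v by rewrite scalerA -rmorphM mulfV ?gt_eqF // scale1r.
have v1 : rdot v v = 1.
  by rewrite rdotZl rdotZr -r2 expr2 mulKf ?mulVf ?gt_eqF.
rewrite ltNge; apply/negP => h; apply: (notS v v1); clearbody v.
apply: (inS _ _ t t1); first exact: rdot_cauchy.
move: h; rewrite uE -scalemxAr !(rdotZl, rdotZr) v1.
move: (rdot v _) (rdot (A *m v) _) (r) r0 => x z k k0 h.
rewrite -(pmulr_rle0 _ (exprn_gt0 2 k0)).
suff -> : k ^+ 2 * (z + s * t * x + q * t ^+ 2)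
  = k * (k * z) + s * t * (k * (k * x)) + q * t ^+ 2 * (k * (k * 1)) by [].
by ring.
Qed.

(* At a singular point the vector [u] lies on the network side of a quadratic
   inequality which each block satisfies strictly in the opposite sense, and
   both sides are additive over the blocks. *)
Lemma decentralized_unit (N : nat) (n : 'I_N -> nat)
    (D : forall i, 'M[R[i]]_(n i)) (H : 'M[R]_(\sum_i n i)) (t : R) :
  (0 < \sum_i n i)%N -> sym_posdef H -> 0 <= t <= 1 ->
  (forall i v, rdot v v = 1 ->
     ~ network_graph H (rdot v (D i *m v), rdot (D i *m v) (D i *m v))) ->
  1%:M + toC t *: (\mxdiag_i D i *m map_mx toC H) \in unitmx.
Proof.
move=> m0 Hs /andP[t0 t1] notS.
have [->|tn0] := eqVneq t 0.
  by rewrite rmorph0 scale0r addr0 unitmx1.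
have {tn0}t0 : 0 < t by rewrite lt0r tn0.
have [s [q [netle inS]]] := network_spectrum _ _ m0 Hs.
have Hu := sym_posdef_unit _ _ Hs.
(* [det0P] yields a left kernel vector; transposing first makes it a right one. *)
rewrite -unitmx_tr unitmxE unitfE; apply/negP => /det0P[y' y'0 yM].
pose y := y'^T.
have y0 : y != 0 by rewrite -trmx0 (inj_eq trmx_inj).
have {yM} : (1%:M + toC t *: (\mxdiag_i D i *m map_mx toC H)) *m y = 0.
  by rewrite -[_ *m y]trmxK trmx_mul trmxK yM trmx0.
rewrite mulmxDl mul1mx -scalemxAl -mulmxA.
set u := map_mx toC H *m y => yE.
have yK : y = map_mx toC (invmx H) *m u.
  by rewrite /u mulmxA -map_mxM mulVmx // map_mx1 mul1mx.
have u0 : u != 0 by apply: contraNneq y0 => u0; rewrite yK u0 mulmx0.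
have Du : \mxdiag_i D i *m u = toC (- t^-1) *: (map_mx toC (invmx H) *m u).
  move/eqP: yE; rewrite addrC addr_eq0 => /eqP /(congr1 (fun x => toC t^-1 *: x)).
  rewrite scalerA -rmorphM mulVf ?gt_eqF // scale1r => ->.
  by rewrite rmorphN scaleNr scalerN yK.
have ti : 1 <= t^-1 by rewrite invf_ge1.
pose form n (A : 'M[R[i]]_n) (v : 'cV[R[i]]_n) :=
  rdot (A *m v) (A *m v) + s * t^-1 * rdot v (A *m v) + q * t^-1 ^+ 2 * rdot v v.
have form_gt0 i v : v != 0 -> 0 < form _ (D i) v.
  by move=> v0; apply: (block_form_gt0 _ _ _ _ _ _ _ ti inS (notS i) v0).
have form_ge0 i v : 0 <= form _ (D i) v.
  have [->|/form_gt0 /ltW //] := eqVneq v 0.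
  by rewrite /form mulmx0 /rdot mulmx0 mxE /= !mulr0 !addr0.
pose v i := submxcol u i.
have uE : u = \mxcol_i v i by rewrite submxcolK.
have sum_form : form _ (\mxdiag_i D i) u = \sum_i form _ (D i) (v i).
  rewrite /form uE mul_mxdiag_mxcol !rdot_mxcol !mulr_sumr -!big_split /=.
  by apply: eq_bigr.
(* By [Du] the form becomes [t^-1 ^+ 2] times the spectral form of [H^-1] at [u], nonpositive by
   [netle]. *)
have le0 : form _ (\mxdiag_i D i) u <= 0.
  rewrite /form Du !(rdotZl, rdotZr); move: (netle u).
  set Ku := map_mx _ _ *m u.
  move: (rdot Ku Ku) (rdot u Ku) (rdot u u) => a b c h.
  have -> : - t^-1 * (- t^-1 * a) + s * t^-1 * (- t^-1 * b) + q * t^-1 ^+ 2 * c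
          = t^-1 ^+ 2 * (a - s * b + q * c) by ring.
  by rewrite pmulr_rle0 // exprn_gt0 // invr_gt0.
have : \sum_i form _ (D i) (v i) == 0.
  by rewrite eq_le -{1}sum_form le0 sumr_ge0.
(* Nonnegative terms with zero sum all vanish; strict positivity on nonzero blocks then forces
   [u = 0]. *)
rewrite psumr_eq0 // => /allP h.
move/negP: u0; apply; rewrite uE -(mxcol0 (p_ := n)); apply/eqP/eq_mxcol => i.
apply/eqP; apply/negPn/negP => /(form_gt0 i).
by rewrite (eqP (h i (mem_index_enum _))) ltxx.
Qed.

End Decentralized.

Theorem mainTheorem2 (R : realType) (N : nat) (hN : (1 <= N)%N)
  (n : 'I_N -> nat) (hn : forall i, (0 < n i)%N)
  (kappa : 'I_N -> R) (Psi V : 'I_N -> set R)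
  (G : forall i : 'I_N, 'cV[R]_3 -> 'M[tf R]_(n i))
  (hG : forall O : 'I_N -> 'cV[R]_3,
      (forall i, admissible (kappa i) (Psi i) (V i) (O i)) ->
      RHinf (\mxdiag_(i < N) G i (O i)))
  (H : 'M[R]_(\sum_(i < N) n i)) (hH : sym_posdef H)
  (O : 'I_N -> 'cV[R]_3)
  (hO : forall i : 'I_N,
      stab_region (admissible (kappa i) (Psi i) (V i)) (G i) H (O i)) :
  feedback_stable (\mxdiag_(i < N) G i (O i)) H.
Proof.
apply: feedback_stable_homotopy.
  by apply: hG => i; case: (hO i).
move=> A t /freq_limit_mxdiag[D -> DP] t01.
apply: decentralized_unit => //.
  (* The total size is positive, so that [H^-1] has extreme eigenvalues. *)
  by rewrite (bigD1 (Ordinal hN)) //= addn_gt0 hn.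
move=> i v v1; have [_ hM] := hO i.
exact: margin_limit hM (DP i) v1.
Qed.
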